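(* Let $\mathcal{H}$ be a concept class that is learnable with $d$ non-adaptive statistical queries. Then $\mathcal{H}$ is $(d+1)$-list replicably learnable. Furthermore, the sample complexity $n=n(\nu,\delta)$ of the $(d+1)$-list replicable algorithm equals $O\!\left(\frac{d^2}{\nu^2}\cdot\log\frac{d}{\delta}\right)$, where $\nu$ is the approximation error parameter of each statistical query oracle.
   Context: A concept (hypothesis) class $\mathcal{H}$ is a class of Boolean functions $X\to\{0,1\}$ on a domain $X$. For a distribution $\mathcal{D}$ over $X$ and $f\in\mathcal{H}$, $\mathcal{D}_f$ is the distribution over $X\times\{0,1\}$ obtained by sampling $x\sim\mathcal{D}$ and outputting $\langle x,f(x)\rangle$. A hypothesis is a (measurable) function $h:X\to\{0,1\}$; its error is $e_{\mathcal{D}_f}(h)=\Pr_{\langle x,f(x)\rangle\sim\mathcal{D}_f}[f(x)\ne h(x)]$, and it is $\varepsilon$-approximate if $e_{\mathcal{D}_f}(h)\le\varepsilon$. Statistical queries: a statistical query oracle $STAT(\mathcal{D}_f,\nu)$ takes as input a function $\phi:X\times\{0,1\}\to(0,1)$ and returns some estimate $v$ with $|v-E_{\langle x,y\rangle\sim\mathcal{D}_f}[\phi(x,y)]|\le\nu$. An algorithm $A$ learns $\mathcal{H}$ via statistical queries if for every $0<\varepsilon<1$ there is $\nu=\nu(\varepsilon)>0$ such that for every distribution $\mathcal{D}$ over $X$ and every $f\in\mathcal{H}$, $A$ on input $\varepsilon$ and with oracle $STAT(\mathcal{D}_f,\nu)$ outputs (for all valid oracle answers) a hypothesis $h$ with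 $e_{\mathcal{D}_f}(h)\le\varepsilon$. $\mathcal{H}$ is learnable with $d$ non-adaptive statistical queries if such an $A$ exists that makes $d$ queries, none of which depends on answers to other queries. $k$-list replicably learnable: there is an algorithm $B$ such that for all $0<\varepsilon<1$, $0<\delta\le1$, with $m=m(\varepsilon,\delta)$ samples, for every $f\in\mathcal{H}$ and every distribution $\mathcal{D}$ over $X$ there is a list $L$ of at most $k$ $\varepsilon$-approximate hypotheses such that, on inputs $\delta,\varepsilon$ and $S\sim\mathcal{D}_f^m$ ($m$ i.i.d. samples), $\Pr_{S\sim\mathcal{D}_f^m}[B(S)\in L]\ge1-\delta$. The number $m$ is the sample complexity and $k$ the list complexity. The constant in $O(\cdot)$ is absolute.
   Formalization: In the sample bound, log(d/δ) is replaced by log(max(2, d/δ)); this matters only for d = 1 and δ > 1/2, because for d = 1 and δ near 1 the literal bound forces zero samples, which is impossible (one-point X, both constant concepts). *)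

(* Defs.v *)
From HB Require Import structures.
From mathcomp Require Export all_boot all_order all_algebra.
From mathcomp Require Export all_classical all_reals all_analysis.

Set Implicit Arguments.
Unset Strict Implicit.
Unset Printing Implicit Defensive.

Import Order.TTheory GRing.Theory Num.Theory.
Import numFieldNormedType.Exports.

Local Open Scope classical_set_scope.
Local Open Scope ring_scope.

Section iid_samples.
Context d (T : measurableType d) (R : realType).

Definition tuple_cons n (p : T * n.-tuple T) : n.+1.-tuple T :=
  [the n.+1.-tuple T of p.1 :: p.2].

Lemma measurable_tuple_cons n :
  measurable_fun [set: T * n.-tuple T] (@tuple_cons n).
Proof. exact: measurable_cons. Qed.

HB.instance Definition _ n :=
  isMeasurableFun.Build _ _ _ _ (@tuple_cons n) (@measurable_tuple_cons n).

(* The [n]-fold product measure of [P], i.e. the law of [n] i.i.d. samples. *)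
Fixpoint iid (P : probability T R) n : probability (n.-tuple T) R :=
  match n with
  | 0 => \d_([tuple] : 0.-tuple T)
  | n'.+1 => distribution (P \x iid P n')%E (@tuple_cons n')
  end.

Lemma iid_rect (P : probability T R) n (A : 'I_n -> set T) :
    (forall i, measurable (A i)) ->
  iid P n [set s | forall i, A i (tnth s i)] = (\prod_(i < n) P (A i))%E.
Proof.
elim: n A => [|n IH] A mA /=.
  by rewrite big_ord0 diracE mem_set// => -[].
rewrite big_ord_recl -IH// /distribution /pushforward.
rewrite [X in (_ \x _)%E X](_ : _ =
    A ord0 `*` [set s : n.-tuple T | forall i, A (lift ord0 i) (tnth s i)]).
  rewrite product_measure1E//.
  rewrite (_ : mkset _ = \bigcap_(i in [set: 'I_n])
      ((fun s : n.-tuple T => tnth s i) @^-1` A (lift ord0 i))); last first.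
    by apply/seteqP; split=> s /= h i; [move=> _; exact: h|exact: h].
  apply: fin_bigcap_measurable; first exact: finite_finset.
  by move=> i _; rewrite -[X in measurable X]setTI; exact: measurable_tnth.
apply/seteqP; split=> -[x s] /=.
  move=> h; split; first by have := h ord0; rewrite /tuple_cons tnth0.
  by move=> i; have := h (lift ord0 i); rewrite /tuple_cons tnthS.
move=> [h0 h] i; case: (unliftP ord0 i) => [j|] ->.
  by rewrite /tuple_cons tnthS; exact: h.
by rewrite /tuple_cons tnth0.
Qed.

End iid_samples.

Section concept_classes.
Context d (X : measurableType d) (R : realType).

Definition labeling (f : {mfun X >-> bool}) (x : X) : X * bool := (x, f x).

Lemma measurable_labeling (f : {mfun X >-> bool}) :
  measurable_fun [set: X] (labeling f).
Proof. by apply: measurable_fun_pair. Qed.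

HB.instance Definition _ (f : {mfun X >-> bool}) :=
  isMeasurableFun.Build _ _ _ _ (labeling f) (measurable_labeling f).

(* The distribution D_f of the labeled example (x, f x) with x drawn from D. *)
Definition labeled (D : probability X R) (f : {mfun X >-> bool}) :
  probability (X * bool)%type R := distribution D (labeling f).

Definition error (D : probability X R) (f h : {mfun X >-> bool}) : \bar R :=
  labeled D f [set z | z.2 != h z.1].

Definition approximate (D : probability X R) (f : {mfun X >-> bool}) (eps : R)
    (h : {mfun X >-> bool}) : Prop :=
  (error D f h <= eps%:E)%E.

(* The queries depend on the accuracy parameter only, never on the answers:
   this is what makes the algorithm non-adaptive. *)
Record nonadaptive_sq_algorithm (q : nat) := NonadaptiveSQ {
  query : R -> 'I_q -> {mfun (X * bool)%type >-> R} ;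
  query_range : forall eps i z, 0 < query eps i z < 1 ;
  answer : R -> ('I_q -> R) -> {mfun X >-> bool} }.

Definition valid_STAT_answer (D : probability X R) (f : {mfun X >-> bool})
    (nu : R) (phi : X * bool -> R) (v : R) : Prop :=
  (`|v%:E - 'E_(labeled D f)[phi]| <= nu%:E)%E.

Definition sq_learns q (A : nonadaptive_sq_algorithm q) (nu : R -> R)
    (H : set {mfun X >-> bool}) : Prop :=
  forall eps, 0 < eps < 1 ->
  0 < nu eps /\
  forall (D : probability X R) f, H f ->
  forall v : 'I_q -> R,
    (forall i, valid_STAT_answer D f (nu eps) (query A eps i) (v i)) ->
    approximate D f eps (answer A eps v).

Definition nonadaptive_sq_learnable_with (H : set {mfun X >-> bool}) (q : nat)
    (nu : R -> R) : Prop :=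
  exists A : nonadaptive_sq_algorithm q, sq_learns A nu H.

Definition nonadaptive_sq_learnable (H : set {mfun X >-> bool}) (q : nat) :
    Prop :=
  exists nu : R -> R, nonadaptive_sq_learnable_with H q nu.

(* [m eps delta] is the sample complexity.  The library's measures are total on
   sets, so the success event is explicitly required to be measurable. *)
Definition list_replicably_learnable_with (H : set {mfun X >-> bool}) (k : nat)
    (m : R -> R -> nat) : Prop :=
  exists B : R -> R -> seq (X * bool) -> {mfun X >-> bool},
  forall eps delta, 0 < eps < 1 -> 0 < delta <= 1 ->
  forall f, H f -> forall D : probability X R,
  exists L : seq {mfun X >-> bool},
    let success :=
      [set S : (m eps delta).-tuple (X * bool) | B eps delta S \in L] in
    [/\ (size L <= k)%N,
        (forall h, h \in L -> approximate D f eps h),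
        measurable success
      & ((1 - delta)%:E <= iid (labeled D f) (m eps delta) success)%E].

Definition list_replicably_learnable (H : set {mfun X >-> bool}) (k : nat) :
    Prop :=
  exists m : R -> R -> nat, list_replicably_learnable_with H k m.

End concept_classes.

(* The expression d^2/nu^2 * log (d/delta) inside the O(.).  The argument of the
   logarithm is truncated below at 2: for d = 1 and delta close to 1 the
   untruncated logarithm tends to 0, whereas the number of samples needed does
   not.  The truncation has no effect when d >= 2 or delta <= 1/2 (for d = 0 the
   whole expression is 0). *)
Definition sample_rate (R : realType) (d : nat) (nu delta : R) : R :=
  d%:R ^+ 2 / nu ^+ 2 * ln (Num.max 2 (d%:R / delta)).

(* Main.v *)
(* Put r = nu / (d + 1) and let p be the vector of the d query expectations; by a
   Chernoff bound and a union bound the empirical means x are, with probability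
   at least 1 - delta, coordinatewise within r of p.  Consider the d + 1 grids of
   cell width 2 * nu = 2 * r * (d + 1), the j-th one being shifted by 2 * r * j.
   The d + 1 families of cell boundaries are interleaved at distance 2 * r, so
   each coordinate of x is within r of a boundary of at most one grid, and for
   some grid no coordinate of x is within r of a boundary.  For that grid x and p
   lie in the same cell, so rounding x to the centre of its cell gives the value
   obtained by rounding p itself: a vector within nu of p that depends only on p
   and j, hence is one of d + 1 vectors, each a valid tuple of oracle answers. *)
From HB Require Import structures.
Require Import Defs.
From mathcomp Require Import lra zify ring measurable_realfun.

Set Implicit Arguments.
Unset Strict Implicit.
Unset Printing Implicit Defensive.

Import Order.TTheory GRing.Theory Num.Theory.
Local Open Scope classical_set_scope.
Local Open Scope ring_scope.

(* From [expR x <= 1 / (1 - x)] and [(1 - x) * (1 + x + 2 * x ^+ 2) >= 1]. *)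
Lemma expR_le_quadratic (R : realType) (x : R) :
  x <= 1 / 2 -> expR x <= 1 + x + 2 * x ^+ 2.
Proof.
move=> x2; have := expR_ge1Dx (- x); rewrite expRN => h.
have e0 := expR_gt0 x.
have h2 : (1 - x) * expR x <= 1.
  by rewrite -ler_pdivlMr// div1r.
nra.
Qed.

(** * Shifted grids: separation and rounding *)

(** A cell boundary of the [j]-th grid, that is an integer congruent to [j] modulo [D.+1], lies in
    []y, y + 1]], and the only integer there is [floor (y + 1)]. *)
Lemma floor_neq_int_between (R : realType) (y : R) (D j : nat) :
  Num.floor ((y - j%:R) / D.+1%:R) != Num.floor ((y + 1 - j%:R) / D.+1%:R) ->
  Num.floor ((y + 1 - j%:R) / D.+1%:R) * (D.+1)%:Z + j%:Z = Num.floor (y + 1).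
Proof.
set a := (y - _) / _; set b := (y + 1 - _) / _ => ab.
have D0 : 0 < D.+1%:R :> R by rewrite ltr0n.
have leab : a <= b by rewrite ler_pM2r ?invr_gt0//; lra.
have lab : a < (Num.floor b)%:~R.
  rewrite ltNge; apply: contra ab => h.
  by rewrite eq_le (le_floor leab) floor_ge_int.
have lb := floor_le b.
have ey : y = a * D.+1%:R + j%:R by rewrite /a divfK ?gt_eqF//; ring.
have eyb : y + 1 = b * D.+1%:R + j%:R by rewrite /b divfK ?gt_eqF//; ring.
symmetry; apply: floor_def.
rewrite !rmorphD rmorphM /=.
have h1 : a * D.+1%:R < (Num.floor b)%:~R * D.+1%:R by rewrite ltr_pM2r.
have h2 : (Num.floor b)%:~R * D.+1%:R <= b * D.+1%:R by rewrite ler_pM2r.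
rewrite -!pmulrn; apply/andP; split; lra.
Qed.

(* Pigeonhole: by the previous lemma, a coordinate [i] spoils the shift [j] only
   if [j] is congruent to [floor (y i + 1)] modulo [d.+1], so the [d] coordinates
   spoil at most [d] of the [d.+1] shifts. *)
Lemma separated_shift_exists (R : realType) (d : nat) (y : 'I_d -> R) :
  exists j : 'I_d.+1, forall i,
    Num.floor ((y i - j%:R) / d.+1%:R) = Num.floor ((y i + 1 - j%:R) / d.+1%:R).
Proof.
apply: contrapT => /forallNP bad.
have {bad}/choice[h hh] (j : 'I_d.+1) : exists i : 'I_d,
    Num.floor ((y i - j%:R) / d.+1%:R) != Num.floor ((y i + 1 - j%:R) / d.+1%:R).
  have /existsNP[i /eqP hi] := bad j.
  by exists i.
have hinj : injective h.
  move=> j j' hjj'; have := floor_neq_int_between (hh j).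
  have := floor_neq_int_between (hh j'); rewrite hjj' => <-.
  set k := Num.floor _; set k' := Num.floor _ => e.
  apply: val_inj => /=; have := ltn_ord j; have := ltn_ord j'.
  move: e; move: (nat_of_ord j) (nat_of_ord j') k k' => a b k k' e bd ad.
  (* Uniqueness of Euclidean division: both remainders are below [d.+1]. *)
  have : k = k' by nia.
  by move=> kk; move: e; rewrite kk; lia.
by have := leq_card h hinj; rewrite !card_ord ltnn.
Qed.
Definition grid_cell (R : realType) (d : nat) (j : 'I_d.+1) (y : R) : int :=
  Num.floor ((y - j%:R) / d.+1%:R).

(** The factor [2 * r] restores the original scale, whereas [grid_cell] expects its argument in
    units of [2 * r]. *)
Definition grid_center (R : realType) (d : nat) (r : R)
    (j : 'I_d.+1) (k : int) : R :=
  2 * r * ((k%:~R + 1 / 2) * d.+1%:R + j%:R).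

(* In units of [2 * r], the cells of the two endpoints [x i - r] and [x i + r]
   in each of the [d.+1] shifted grids. *)
Definition grid_code (R : realType) (d : nat) (r : R) (x : 'I_d -> R) :
    {ffun 'I_d.+1 * 'I_d * bool -> int} :=
  [ffun t : 'I_d.+1 * 'I_d * bool =>
     grid_cell t.1.1 ((x t.1.2 - r) / (2 * r) + (t.2 : nat)%:R)].

(** The picked shift depends on the code alone. By [separated_shift_exists] the default is never
    reached on the code of a vector. *)
Definition grid_decode (R : realType) (d : nat) (r : R)
    (c : {ffun 'I_d.+1 * 'I_d * bool -> int}) : 'I_d -> R :=
  if [pick j | [forall i, c (j, i, false) == c (j, i, true)]] is Some j
  then fun i => grid_center r j (c (j, i, true)) else fun=> 0.

Lemma grid_cell_homo (R : realType) (d : nat) (j : 'I_d.+1) (y z : R) :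
  y <= z -> grid_cell j y <= grid_cell j z.
Proof. by move=> yz; rewrite le_floor// ler_pM2r ?invr_gt0 ?ltr0n// lerB. Qed.

(** Half the width of a cell is [r * d.+1], which is the oracle tolerance [nu] once
    [r = nu / d.+1]. *)
Lemma grid_center_dist (R : realType) (d : nat) (r p : R) (j : 'I_d.+1) :
  0 < r -> `|grid_center r j (grid_cell j (p / (2 * r))) - p| <= r * d.+1%:R.
Proof.
move=> r0; rewrite /grid_center /grid_cell.
set q := p / (2 * r); have -> : p = 2 * r * q.
  by rewrite /q mulrC divfK// gt_eqF// mulr_gt0.
set a := (q - _) / _; have D0 : 0 < d.+1%:R :> R by rewrite ltr0n.
have -> : q = a * d.+1%:R + j%:R by rewrite /a divfK ?gt_eqF//; ring.
set k := (Num.floor a)%:~R.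
have ka : k <= a by exact: floor_le.
have ak : a < k + 1 by rewrite /k -[1]/(1%:~R) -intrD floorD1_gt.
have -> : 2 * r * ((k + 1 / 2) * d.+1%:R + j%:R) - 2 * r * (a * d.+1%:R + j%:R)
  = (r * d.+1%:R) * (2 * (k - a) + 1) by field.
have rD0 : 0 <= r * d.+1%:R by rewrite mulr_ge0 ?ltW.
rewrite normrM (ger0_norm rD0) ler_piMr//.
by rewrite ler_norml; apply/andP; split; lra.
Qed.

(** Each [p i] lies between [x i - r] and [x i + r]; when these endpoints share a cell of the picked
    grid, monotonicity of [grid_cell] squeezes [p i] into it. *)
Lemma grid_decode_code (R : realType) (d : nat) (r : R) (x p : 'I_d -> R) :
  0 < r -> (forall i, `|x i - p i| <= r) ->
  exists j : 'I_d.+1, grid_decode r (grid_code r x) =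
    fun i => grid_center r j (grid_cell j (p i / (2 * r))).
Proof.
move=> r0 xp; rewrite /grid_decode.
case: pickP => [j /forallP cj|no]; last first.
  have [j jE] := separated_shift_exists (fun i => (x i - r) / (2 * r)).
  have /negP[] := negbT (no j); apply/forallP => i.
  by rewrite !ffunE /grid_cell /= addr0; apply/eqP/jE.
exists j; apply/funext => i; congr grid_center.
have := cj i; rewrite !ffunE /= addr0 => /eqP cji.
have r20 : 0 < 2 * r by rewrite mulr_gt0.
have := xp i; rewrite ler_norml => /andP[xp1 xp2].
apply/eqP; rewrite eq_le; apply/andP; split.
  by rewrite -cji grid_cell_homo// ler_pM2r ?invr_gt0//; lra.
apply: grid_cell_homo; rewrite ler_pdivrMr// mulrDl divfK ?gt_eqF//; lra.
Qed.

(** * Measurability of the code *)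

Lemma measurable_floor_fiber (R : realType) disp (T : measurableType disp)
    (g : T -> R) (k : int) :
  measurable_fun [set: T] g -> measurable [set s | Num.floor (g s) = k].
Proof.
move=> mg.
rewrite (_ : [set s | _] = g @^-1` `[k%:~R, (k + 1)%:~R[%classic).
  by rewrite -[X in measurable X]setTI; exact: mg.
apply/seteqP; split=> s /=.
  by move=> <-; rewrite in_itv /= floor_le floorD1_gt.
by rewrite in_itv /= => ?; exact: floor_def.
Qed.

(** Codes form a countable type, so the preimage of an arbitrary set of codes is a countable union
    of finite intersections of floor fibres. This serves to make the success event measurable. *)
Lemma measurable_grid_code (R : realType) (d : nat) (r : R)
    disp (T : measurableType disp) (x : T -> 'I_d -> R)
    (Q : set {ffun 'I_d.+1 * 'I_d * bool -> int}) :
  (forall i, measurable_fun [set: T] (x ^~ i)) ->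
  measurable [set s | Q (grid_code r (x s))].
Proof.
move=> mx.
pose F c := if `[< Q c >] then \bigcap_(t in [set: 'I_d.+1 * 'I_d * bool])
  [set s | grid_code r (x s) t = c t] else set0.
rewrite (_ : [set s | _] = \bigcup_c F c); last first.
  apply/seteqP; split=> s /=.
    by move=> Qs; exists (grid_code r (x s)) => //; rewrite /F asboolT.
  move=> [c _]; rewrite /F; case: asboolP => // Qc h.
  by have -> : grid_code r (x s) = c by apply/ffunP => t; exact: h.
apply: countable_bigcupT_measurable => [|c]; first exact: countableP.
rewrite /F; case: ifP => // _.
apply: fin_bigcap_measurable => [|t _]; first exact: finite_finset.
under eq_set do rewrite ffunE.
apply: measurable_floor_fiber; apply: measurable_funM => //.
apply: measurable_funB => //; apply: measurable_funD => //.
by apply: measurable_funM => //; apply: measurable_funB => //; exact: mx.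
Qed.

(** * Chernoff bound for i.i.d. sums *)

(** Independence of the samples, by induction: Tonelli splits off the first coordinate. It factors
    the moment generating function of a sum. *)
Lemma integral_iid_prod d (T : measurableType d) (R : realType)
    (P : probability T R) (g : T -> R) n :
  measurable_fun [set: T] g -> (forall x, 0 <= g x) ->
  (\int[iid P n]_s (\prod_(i < n) g (tnth s i))%:E =
   (\int[P]_x (g x)%:E) ^+ n)%E.
Proof.
move=> mg g0.
have mprod k : measurable_fun [set: k.-tuple T]
    (fun s => (\prod_(i < k) g (tnth s i))%:E).
  apply/measurable_EFinP; apply: measurable_prod => i _.
  by apply: measurableT_comp => //; exact: measurable_tnth.
have prod0 k (s : k.-tuple T) : (0 <= (\prod_(i < k) g (tnth s i))%:E)%E.
  by rewrite lee_fin prodr_ge0.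
elim: n => [|n IH].
  rewrite integral_dirac//; last exact: (mprod 0).
  by rewrite diracE mem_set// mul1e big_ord0.
rewrite expeS -IH /= (ge0_integral_distribution _ (mprod n.+1) (prod0 n.+1)).
pose F (z : T * n.-tuple T) :=
  ((g z.1)%:E * (\prod_(i < n) g (tnth z.2 i))%:E)%E.
rewrite (_ : _ \o _ = F); last first.
  apply/funext => -[x s]; rewrite /F /tuple_cons /= big_ord_recl -EFinM tnth0.
  by congr (_ * _)%:E; apply: eq_bigr => i _; rewrite tnthS.
have mF : measurable_fun [set: T * n.-tuple T] F.
  apply: emeasurable_funM.
    by apply/measurable_EFinP; exact: measurableT_comp.
  exact: measurableT_comp (mprod n) measurable_snd.
rewrite fubini_tonelli1//; last first.
  by move=> z; rewrite mule_ge0// lee_fin.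
rewrite /fubini_F /F /=.
transitivity (\int[P]_x ((g x)%:E *
    \int[iid P n]_s (\prod_(i < n) g (tnth s i))%:E))%E.
  apply: eq_integral => x _; apply: ge0_integralZl_EFin => //.
    by move=> s _; exact: prod0.
  exact: mprod.
rewrite ge0_integralZr//.
- exact/measurable_EFinP.
- by move=> x _; rewrite lee_fin.
by apply: integral_ge0 => s _; exact: prod0.
Qed.

Lemma bounded_rv_integrable d (T : measurableType d) (R : realType)
    (P : probability T R) (Y : T -> R) (M : R) :
  measurable_fun [set: T] Y -> (forall x, `|Y x| <= M) ->
  P.-integrable [set: T] (EFin \o Y).
Proof.
move=> mY YM; apply: measurable_bounded_integrable => //.
  exact: le_lt_trans (probability_le1 P measurableT) (ltry 1).
exists M; split; first exact: num_real.
by move=> N MN x _ /=; apply: le_trans (YM x) (ltW MN).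
Qed.

(** Since [t * Y x <= 1 / 2], [expR_le_quadratic] applies pointwise; the linear term integrates to
    0, and [1 + 2 * t ^+ 2 <= expR (2 * t ^+ 2)]. *)
Lemma centered_mgf_le d (T : measurableType d) (R : realType)
    (P : probability T R) (Y : T -> R) (t : R) :
  measurable_fun [set: T] Y -> (forall x, `|Y x| <= 1) ->
  (\int[P]_x (Y x)%:E = 0)%E -> 0 <= t <= 1 / 2 ->
  (\int[P]_x (expR (t * Y x))%:E <= (expR (2 * t ^+ 2))%:E)%E.
Proof.
move=> mY Y1 EY /andP[t0 t2].
have tYle x : t * Y x <= 1 / 2.
  have := Y1 x; rewrite ler_norml => /andP[? ?]; nra.
pose c := 1 + 2 * t ^+ 2.
apply: (@le_trans _ _ (\int[P]_x ((t * Y x)%:E + c%:E))%E).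
  have mtY : measurable_fun [set: T] (fun x => t * Y x).
    exact: measurable_funM.
  apply: le_integral => //.
  - apply: (@bounded_rv_integrable _ _ _ _ _ (expR (1 / 2))).
      exact: measurableT_comp.
    by move=> x; rewrite ger0_norm ?expR_ge0// ler_expR.
  - apply: integrableD => //; last exact: finite_measure_integrable_cst.
    apply: (@bounded_rv_integrable _ _ _ _ _ t) => // x.
    by rewrite normrM ger0_norm// ler_piMr.
  - move=> x _; rewrite lee_fin (le_trans (expR_le_quadratic (tYle x)))//.
    have := Y1 x; rewrite ler_norml /c => /andP[? ?].
    have : (t * Y x) ^+ 2 <= t ^+ 2 by rewrite exprMn ler_piMr ?sqr_ge0//; nra.
    lra.
rewrite integralD_EFin//; last first.
- exact: finite_measure_integrable_cst.
- apply: (@bounded_rv_integrable _ _ _ _ _ t); first exact: measurable_funM.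
  by move=> x; rewrite normrM ger0_norm// ler_piMr.
have -> : (\int[P]_x (EFin \o (fun x => t * Y x)%R) x = 0)%E.
  rewrite /=; under eq_integral do rewrite EFinM.
  rewrite integralZl// ?EY ?mule0//.
  exact: (@bounded_rv_integrable _ _ _ _ _ 1).
rewrite add0e integral_cst//= probability_setT mule1 lee_fin.
exact: expR_ge1Dx.
Qed.

Lemma iid_sum_tail d (T : measurableType d) (R : realType)
    (P : probability T R) (Y : T -> R) n (t : R) :
  measurable_fun [set: T] Y -> (forall x, `|Y x| <= 1) ->
  (\int[P]_x (Y x)%:E = 0)%E -> 0 < t <= 1 ->
  (iid P n [set s | n%:R * t <= \sum_(i < n) Y (tnth s i)]%R <=
    (expR (- (n%:R * t ^+ 2 / 8)))%:E)%E.
Proof.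
move=> mY Y1 EY /andP[t0 t1].
pose X (s : n.-tuple T) := \sum_(i < n) Y (tnth s i).
have mX : measurable_fun [set: n.-tuple T] X.
  apply: measurable_sum => i.
  by apply: measurableT_comp => //; exact: measurable_tnth.
pose mXb := isMeasurableFun.Build _ _ _ _ X mX.
pose X' : {mfun n.-tuple T >-> R} := HB.pack X mXb.
(* The Chernoff parameter [t / 4] minimises [2 * l ^+ 2 - l * t] over [l], with minimum
   [- t ^+ 2 / 8]. *)
have t40 : 0 < t / 4 by rewrite divr_gt0.
apply: (le_trans (chernoff (P := iid P n) X' (n%:R * t) t40)).
rewrite /mmt_gen_fun unlock /=.
have -> : (\int[iid P n]_s (expR (X s * (t / 4)))%:E =
    (\int[P]_x (expR (t / 4 * Y x))%:E) ^+ n)%E.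
  rewrite -integral_iid_prod.
  - apply: eq_integral => s _; rewrite -expR_sum /X mulrC mulr_sumr//.
  - by apply: measurableT_comp => //; exact: measurable_funM.
  - by move=> x; exact: expR_ge0.
have h : ((\int[P]_x (expR (t / 4 * Y x))%:E) ^+ n <=
    (expR (2 * (t / 4) ^+ 2) ^+ n)%:E)%E.
  have : (0 <= \int[P]_x (expR (t / 4 * Y x))%:E)%E.
    by apply: integral_ge0 => x _; rewrite lee_fin expR_ge0.
  have : (\int[P]_x (expR (t / 4 * Y x))%:E <= (expR (2 * (t / 4) ^+ 2))%:E)%E.
    by apply: centered_mgf_le => //; apply/andP; split; lra.
  (* The two bounds exclude infinite values of the integral. *)
  case: (integral _ _ _) => // a; rewrite !lee_fin -EFin_expe lee_fin => ac a0.
  by rewrite lerXn2r ?nnegrE ?expR_ge0.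
apply: (le_trans (lee_wpmul2r _ h)).
  by rewrite lee_fin expR_ge0.
rewrite -EFinM lee_fin -expRM_natl -expRD ler_expR.
by rewrite le_eqVlt; apply/orP; left; apply/eqP; field.
Qed.

Lemma measure_union_bound d (T : measurableType d) (R : realType)
    (P : probability T R) k (A : 'I_k -> set T) (c : R) :
  (forall i, measurable (A i)) -> (forall i, P (A i) <= c%:E)%E ->
  (P (\bigcup_i A i) <= (k%:R * c)%:E)%E.
Proof.
move=> mA Ac.
have [_] : measurable (\big[setU/set0]_(i < k) A i) /\
    (P (\big[setU/set0]_(i < k) A i) <= \sum_(i < k) c%:E)%E.
  elim/big_rec2: _ => [|i y1 y2 _ [my2 Pyc]]; first by rewrite measure0.
  split; first exact: measurableU.
  by apply: le_trans (leeD (Ac i) Pyc); exact: measureU2.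
rewrite sumEFin sumr_const card_ord mulr_natl; apply: le_trans.
rewrite le_eqVlt; apply/orP; left; apply/eqP; congr (P _).
apply/seteqP; split => x; first by move=> [i _ Ai]; rewrite (bigD1 i)//=; left.
by rewrite -bigcup_seq => -[i _ Ai]; exists i.
Qed.

(** * Empirical means of the queries *)

Definition empirical_mean (T : Type) (R : realType) (phi : T -> R)
    (s : seq T) : R :=
  (\sum_(z <- s) phi z) / (size s)%:R.

Lemma measurable_empirical_mean d (T : measurableType d) (R : realType)
    (phi : T -> R) n :
  measurable_fun [set: T] phi ->
  measurable_fun [set: n.-tuple T] (fun s => empirical_mean phi s).
Proof.
move=> mphi; rewrite /empirical_mean.
under eq_fun do rewrite big_tuple size_tuple.
apply: measurable_funM => //; apply: measurable_sum => i.
by apply: measurableT_comp => //; exact: measurable_tnth.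
Qed.

Lemma measurable_empirical_mean_deviation d (T : measurableType d) (R : realType)
    (phi : T -> R) n (p r : R) :
  measurable_fun [set: T] phi ->
  measurable [set s : n.-tuple T | r < `|empirical_mean phi s - p|].
Proof.
move=> mphi.
have mdev : measurable_fun [set: n.-tuple T]
    (fun s => `|empirical_mean phi s - p|).
  apply: measurableT_comp => //; apply: measurable_funB => //.
  exact: measurable_empirical_mean.
rewrite (_ : mkset _ =
    (fun s : n.-tuple T => `|empirical_mean phi s - p|) @^-1`
      `]r, +oo[%classic).
  by rewrite -[X in measurable X]setTI; exact: mdev.
by apply/seteqP; split=> s /=; rewrite in_itv /= andbT.
Qed.

(** Passes from extended to real expectations. The bounds serve twice: centered queries have
    absolute value at most 1, and 0 is a valid answer when [1 <= nu]. *)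
Lemma expectation_unit_interval d (T : measurableType d) (R : realType)
    (P : probability T R) (phi : {mfun T >-> R}) :
  (forall x, 0 < phi x < 1) ->
  'E_P[phi]%E = (fine 'E_P[phi])%:E /\ 0 <= fine 'E_P[phi]%E <= 1.
Proof.
move=> phi01.
have iphi : P.-integrable [set: T] (EFin \o phi).
  apply: (@bounded_rv_integrable _ _ _ _ _ 1) => // x.
  by have /andP[? ?] := phi01 x; rewrite ger0_norm ltW.
have pE : 'E_P[phi]%E = (fine 'E_P[phi])%:E.
  by rewrite unlock fineK// integrable_fin_num.
split=> //; apply/andP; split; rewrite -lee_fin -pE unlock.
  apply: integral_ge0 => x _.
  by rewrite lee_fin ltW//; case/andP: (phi01 x).
apply: (@le_trans _ _ (\int[P]_x (cst 1%:E x))%E).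
  apply: le_integral => //; first exact: finite_measure_integrable_cst.
  by move=> x _; rewrite lee_fin ltW//; case/andP: (phi01 x).
by rewrite integral_cst//= probability_setT mule1.
Qed.

Lemma empirical_mean_tail d (T : measurableType d) (R : realType)
    (P : probability T R) (phi : {mfun T >-> R}) n (r : R) :
  (forall x, 0 < phi x < 1) -> (0 < n)%N -> 0 < r <= 1 ->
  (iid P n [set s : n.-tuple T |
      r < `|empirical_mean phi s - fine 'E_P[phi]|]%R <=
    (2 * expR (- (n%:R * r ^+ 2 / 8)))%:E)%E.
Proof.
move=> phi01 n0 r01.
have iphi : P.-integrable [set: T] (EFin \o phi).
  apply: (@bounded_rv_integrable _ _ _ _ _ 1) => // x.
  by have /andP[? ?] := phi01 x; rewrite ger0_norm ltW.
have [pE /andP[p0 p1]] := expectation_unit_interval P phi01.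
move: pE p0 p1; set p := fine _; rewrite unlock => pE p0 p1.
(* The sign reduces lower deviations to upper ones; the two values of [b] give the factor 2. *)
pose Y (b : bool) (x : T) := (-1) ^+ b * (phi x - p).
have mY b : measurable_fun [set: T] (Y b).
  by apply: measurable_funM => //; exact: measurable_funB.
have Y1 b x : `|Y b x| <= 1.
  rewrite /Y normrM normr_sign mul1r ler_norml.
  by have /andP[? ?] := phi01 x; apply/andP; split; lra.
have EY b : (\int[P]_x (Y b x)%:E = 0)%E.
  rewrite /Y; under eq_integral do rewrite EFinM.
  have ip : P.-integrable [set: T] (EFin \o cst p).
    exact: finite_measure_integrable_cst.
  rewrite integralZl//; last first.
    apply: (@bounded_rv_integrable _ _ _ _ (fun x => phi x - p) 1).
      exact: measurable_funB.
    by move=> x; have := Y1 false x; rewrite /Y mul1r.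
  rewrite (_ : (\int[P]_x (phi x - p)%:E)%E = 0%E) ?mule0//.
  under eq_integral do rewrite EFinB.
  rewrite integralB_EFin//.
  by rewrite pE integral_cst//= probability_setT mule1 subee.
pose A (b : bool) :=
  [set s : n.-tuple T | n%:R * r <= \sum_(i < n) Y b (tnth s i)].
have mA b : measurable (A b).
  pose X (s : n.-tuple T) := \sum_(i < n) Y b (tnth s i).
  have mX : measurable_fun [set: n.-tuple T] X.
    apply: measurable_sum => i.
    by apply: measurableT_comp => //; exact: measurable_tnth.
  rewrite (_ : A b = X @^-1` `[n%:R * r, +oo[%classic).
    by rewrite -[X in measurable X]setTI; exact: mX.
  by apply/seteqP; split=> s /=; rewrite in_itv /= andbT.
apply: (@le_trans _ _ (iid P n (A false `|` A true))).
  apply: le_measure; rewrite ?inE.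
  - exact: measurable_empirical_mean_deviation.
  - exact: measurableU.
  move=> s /=; rewrite /A /empirical_mean big_tuple size_tuple /=.
  have SY b : \sum_(i < n) Y b (tnth s i) =
      n%:R * ((-1) ^+ b * ((\sum_(i < n) phi (tnth s i)) / n%:R - p)).
    rewrite -mulr_sumr sumrB sumr_const card_ord -mulr_natl.
    by field; rewrite pnatr_eq0 -lt0n.
  rewrite !SY !ler_pM2l ?ltr0n// expr0 expr1 mul1r mulN1r.
  by rewrite ltr_normr => /orP[|] h; [left|right]; exact: ltW.
apply: (le_trans (measureU2 _ (mA false) (mA true))).
rewrite mulr_natl mulr2n EFinD.
by apply: leeD; exact: iid_sum_tail.
Qed.

(** * Sample size *)

(** At [1 / 2] the quadratic bound on [expR] equals 2. *)
Lemma half_le_ln2 (R : realType) : 1 / 2 <= ln 2 :> R.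
Proof.
rewrite -ler_expR lnK ?posrE//.
by apply: (le_trans (expR_le_quadratic (lexx _))); lra.
Qed.

(* For [d = 0] [sample_rate] is [0], and for [1 <= nu] any answer in [[0, 1]]
   is a valid estimate; both cases are served without samples. *)
Definition sample_size (R : realType) (d : nat) (nu delta : R) : nat :=
  if (d == 0) || (1 <= nu) then 0
  else (Num.truncn (8 * (d.+1%:R / nu) ^+ 2 * ln (2 * d%:R / delta))).+1.

(** With [a = d / nu >= 1], [d.+1 / nu <= 2 * a] costs a factor 4 and the logarithm a factor 2, so
    the main term is at most [64 * a ^+ 2 * ln M]. The [+ 1] from rounding is at most
    [2 * a ^+ 2 * ln M], as [ln M >= 1 / 2]. *)
Lemma sample_size_le (R : realType) (d : nat) (nu delta : R) :
  0 < nu -> 0 < delta <= 1 ->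
  (sample_size d nu delta)%:R <= 66 * sample_rate d nu delta.
Proof.
move=> nu0 /andP[delta0 delta1]; rewrite /sample_size /sample_rate.
set M := Num.max _ _; have M2 : 2 <= M by rewrite /M le_max lexx.
have L2 : 1 / 2 <= ln M.
  by apply: (le_trans (half_le_ln2 R)); rewrite ler_ln ?posrE//; lra.
have [_|/norP[d0 /negbTE nu1]] := ifPn.
  by rewrite mulr_ge0// mulr_ge0 ?divr_ge0 ?sqr_ge0//; lra.
have d1 : 1 <= d%:R :> R by rewrite ler1n lt0n.
have a1 : 1 <= d%:R / nu.
  by rewrite ler_pdivlMr// mul1r (le_trans _ d1)// ltW// ltNge nu1.
(* Both 2 and [d / delta] are at most [M], so their product is at most [M ^+ 2]. *)
have lnle : ln (2 * d%:R / delta) <= 2 * ln M.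
  have dM : d%:R / delta <= M by rewrite /M le_max lexx orbT.
  have dd0 : 0 < d%:R / delta by rewrite divr_gt0//; lra.
  have M0 : 0 < M by exact: lt_le_trans M2.
  have -> : 2 * ln M = ln (M ^+ 2) by rewrite lnXn// mulr_natl.
  by rewrite ler_ln ?posrE ?exprn_gt0//; nra.
have ln0 : 0 <= ln (2 * d%:R / delta).
  apply: ln_ge0; rewrite ler_pdivlMr// mul1r; lra.
rewrite -addn1 natrD.
set q := d.+1%:R / nu; have q0 : 0 <= q by rewrite divr_ge0// ltW.
have q2a : q <= 2 * (d%:R / nu).
  by rewrite mulrA ler_pM2r ?invr_gt0// -addn1 natrD; lra.
have tr : (Num.truncn (8 * q ^+ 2 * ln (2 * d%:R / delta)))%:R <=
    8 * q ^+ 2 * ln (2 * d%:R / delta).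
  rewrite truncn_le; apply: mulr_ge0 => //; apply: mulr_ge0 => //.
  exact: sqr_ge0.
rewrite -expr_div_n; move: (d%:R / nu) a1 q2a tr => a a1 q2a tr.
have qa : q ^+ 2 <= 4 * a ^+ 2 by nra.
have : q ^+ 2 * ln (2 * d%:R / delta) <= 4 * a ^+ 2 * (2 * ln M).
  by apply: ler_pM => //; rewrite sqr_ge0.
have a2 : 1 <= a ^+ 2 by rewrite expr_ge1//; lra.
nra.
Qed.

(** The size is obtained by solving [d * 2 * expR (- (n * r ^+ 2 / 8)) = delta] for [n], with
    [r = nu / d.+1], and rounding up. *)
Lemma sample_size_tail_le (R : realType) (d : nat) (nu delta : R) :
  (0 < d)%N -> 0 < nu < 1 -> 0 < delta <= 1 ->
  d%:R * (2 * expR (- ((sample_size d nu delta)%:R * (nu / d.+1%:R) ^+ 2 / 8)))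
    <= delta.
Proof.
move=> d0 /andP[nu0 nu1] /andP[delta0 delta1].
rewrite /sample_size (gtn_eqF d0) (leNgt 1) nu1 /=.
have dR0 : 0 < d%:R :> R by rewrite ltr0n.
set l := ln _; set q := d.+1%:R / nu.
have q0 : 0 < q by rewrite divr_gt0.
have -> : nu / d.+1%:R = q^-1 by rewrite invf_div.
set n := (Num.truncn _).+1%:R.
have nlt : 8 * q ^+ 2 * l <= n by exact/ltW/truncnS_gt.
have lle : l <= n * q^-1 ^+ 2 / 8.
  by rewrite exprVn ler_pdivlMr// ler_pdivlMr ?exprn_gt0//; lra.
have -> : delta = d%:R * (2 * expR (- l)).
  rewrite expRN /l lnK ?posrE ?divr_gt0// ?mulr_gt0//; field.
  by rewrite !gt_eqF.
by rewrite !ler_pM2l// ler_expR lerN2.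
Qed.

(** * The list replicable learner *)

Lemma nonadaptive_sq_list_replicable (R : realType)
    disp (X : measurableType disp) (H : set {mfun X >-> bool}) (d : nat) (nu : R -> R) :
  nonadaptive_sq_learnable_with H d nu ->
  list_replicably_learnable_with H d.+1
    (fun eps delta => sample_size d (nu eps) delta).
Proof.
move=> [A learnA].
pose r eps := nu eps / d.+1%:R.
(* The test is that of [sample_size]: where no sample is drawn, the zero vector replaces the
   estimates. *)
pose B eps (delta : R) (S : seq (X * bool)) := answer A eps
  (if (d == 0) || (1 <= nu eps) then fun=> 0
   else grid_decode (r eps)
     (grid_code (r eps) (fun i => empirical_mean (query A eps i) S))).
exists B => eps delta eps01 delta01 f Hf D.
have [nu0 {}learnA] := learnA eps eps01; have {}learnA := learnA D f Hf.
pose P := labeled D f.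
pose p i := fine 'E_P[query A eps i]%E.
have pE i : 'E_P[query A eps i]%E = (p i)%:E.
  by have [] := expectation_unit_interval P (query_range A eps i).
have p01 i : 0 <= p i <= 1.
  by have [] := expectation_unit_interval P (query_range A eps i).
have approx v : (forall i, `|v i - p i| <= nu eps) ->
    approximate D f eps (answer A eps v).
  move=> vp; apply: learnA => i.
  by rewrite /valid_STAT_answer -/P pE -EFinB abse_EFin lee_fin.
have /andP[delta0 delta1] := delta01.
have [triv|/norP[d0]] := boolP ((d == 0) || (1 <= nu eps)).
  exists [:: answer A eps (fun=> 0)].
  rewrite (_ : mkset _ = setT); last first.
    by apply/seteqP; split=> S //= _; rewrite /B triv mem_head.
  split=> //.
  - move=> h; rewrite inE => /eqP ->; apply: approx => i.
    case/orP: triv => [/eqP d0|nu1]; first by have := ltn_ord i; rewrite {2}d0.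
    by rewrite sub0r normrN; have /andP[? ?] := p01 i; rewrite ger0_norm//; lra.
  - by rewrite probability_setT lee_fin; lra.
rewrite -lt0n in d0 => nu1; rewrite -ltNge in nu1.
have r0 : 0 < r eps by rewrite divr_gt0.
have rle : r eps <= 1.
  by rewrite /r ler_pdivrMr// mul1r (le_trans (ltW nu1))// ler1n.
pose v (j : 'I_d.+1) i :=
  grid_center (r eps) j (grid_cell j (p i / (2 * r eps))).
(* The list is built from the true expectations [p], hence is fixed before sampling. *)
pose L := [seq answer A eps (v j) | j <- enum 'I_d.+1].
exists L.
set n := sample_size d (nu eps) delta; set success := mkset _.
have msuccess : measurable success.
  rewrite /success /B (gtn_eqF d0) (leNgt 1) nu1 /=.
  apply: (measurable_grid_code (r eps)
    (x := fun (S : n.-tuple (X * bool)) i => empirical_mean (query A eps i) S)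
    [set c | answer A eps (grid_decode (r eps) c) \in L]) => i.
  exact: measurable_empirical_mean.
split=> //; first by rewrite size_map size_enum_ord.
  move=> h /mapP[j _ ->]; apply: approx => i.
  by rewrite (le_trans (grid_center_dist _ _ r0))// /r divfK// pnatr_eq0.
pose bad i := [set S : n.-tuple (X * bool) |
  r eps < `|empirical_mean (query A eps i) S - p i|].
have mbad i : measurable (bad i) by exact: measurable_empirical_mean_deviation.
have n0 : (0 < n)%N by rewrite /n /sample_size (gtn_eqF d0) (leNgt 1) nu1.
have Pbad : (iid P n (\bigcup_i bad i) <= delta%:E)%E.
  have nu01 : 0 < nu eps < 1 by rewrite nu0 nu1.
  have := sample_size_tail_le d0 nu01 delta01.
  rewrite -/(r eps) -/n -lee_fin; apply: le_trans.
  apply: measure_union_bound => // i.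
  by apply: empirical_mean_tail => //; [exact: query_range|rewrite r0].
have mbads : measurable (\bigcup_i bad i).
  by apply: fin_bigcup_measurable => //; exact: finite_finset.
(* Outside the bad events every empirical mean is within [r eps] of [p], so [grid_decode_code]
   yields one of the vectors [v j]. *)
apply: (@le_trans _ _ (iid P n (~` (\bigcup_i bad i)))).
  by rewrite probability_setC// EFinB leeB.
apply: le_measure; rewrite ?inE//; first exact: measurableC.
move=> S /= nbad.
have [|j vE] := @grid_decode_code R d (r eps)
    (fun i => empirical_mean (query A eps i) S) p r0.
  by move=> i; rewrite leNgt; apply/negP => h; apply: nbad; exists i.
rewrite /success /= /B (gtn_eqF d0) (leNgt 1) nu1 /= vE.
by apply/mapP; exists j => //; rewrite mem_enum.
Qed.

(** [C] is chosen before the space, the class, [d] and [nu], as an absolute constant must be. *)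
Theorem theorem5p6 (R : realType) :
  (forall (disp : measure_display) (X : measurableType disp)
      (H : set {mfun X >-> bool}) (d : nat),
    nonadaptive_sq_learnable R H d -> list_replicably_learnable R H d.+1) /\
  exists2 C : R, 0 < C &
    forall (disp : measure_display) (X : measurableType disp)
      (H : set {mfun X >-> bool}) (d : nat) (nu : R -> R),
    nonadaptive_sq_learnable_with H d nu ->
    exists n : R -> R -> nat,
      (forall nu0 delta : R, 0 < nu0 -> 0 < delta <= 1 ->
        (n nu0 delta)%:R <= C * sample_rate d nu0 delta) /\
      list_replicably_learnable_with H d.+1
        (fun eps delta => n (nu eps) delta).
Proof.
split=> [disp X H d [nu /nonadaptive_sq_list_replicable HL]|].
  by exists (fun eps delta => sample_size d (nu eps) delta).
exists 66 => // disp X H d nu /nonadaptive_sq_list_replicable HL.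
exists (@sample_size R d); split=> //.
exact: sample_size_le.
Qed.
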